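(* For every real $x\ge 2$, $$T_3(x)=x\left(\frac{\log^2 x}{2}+(3\gamma-1)\log x+3\gamma^2-3\gamma-3\gamma_1+1\right)+\Delta_3(x),$$ where the error term satisfies $$|\Delta_3(x)|\le 3.369\,x^{2/3}\log^{1/3}x.$$
   Context: For a positive integer $n$, $d_3(n)$ denotes the number of ordered triples $(m_1,m_2,m_3)$ of positive integers with $m_1m_2m_3=n$, and $T_3(x)=\sum_{n\le x}d_3(n)$. $\gamma$ is Euler's constant, and for a non-negative integer $r$ the Euler--Stieltjes constant is $\gamma_r=\lim_{x\to\infty}\left(\sum_{n\le x}\frac{\log^r n}{n}-\frac{\log^{r+1}x}{r+1}\right)$ (so $\gamma_0=\gamma$). The quantity $\Delta_3(x)$ is defined by the displayed identity. *)

(* Defs.v *)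
From Stdlib Require Import Reals Arith List ZArith Lra.
From Coquelicot Require Import Coquelicot.
Open Scope R_scope.

(* Every factor of a positive n is at most n, so for n > 0 the search box
   [1, n]^3 contains all the triples to be counted. *)
Definition d3 (n : nat) : nat :=
  length (filter (fun t => Nat.eqb (fst (fst t) * snd (fst t) * snd t) n)
            (list_prod (list_prod (seq 1 n) (seq 1 n)) (seq 1 n))).

(* The sum of f n over positive integers n <= x. [Int_part] is the floor, and
   [sum_n_m f 1 0] is the empty sum. *)
Definition sum_le (f : nat -> R) (x : R) : R :=
  sum_n_m f 1 (Z.to_nat (Int_part x)).

Definition T3 (x : R) : R := sum_le (fun n => INR (d3 n)) x.

Definition euler_gamma : R :=
  real (Lim_seq (fun n => sum_n_m (fun k => 1 / INR k) 1 n - ln (INR n))).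

(* The term n = 1 is 1 when r = 0, because [pow 0 0 = 1]. *)
Definition stieltjes (r : nat) : R :=
  real (Lim (fun x => sum_le (fun n => ln (INR n) ^ r / INR n) x
                      - ln x ^ (r + 1) / INR (r + 1)) p_infty).

Definition main_term3 (x : R) : R :=
  x * (ln x ^ 2 / 2 + (3 * euler_gamma - 1) * ln x
       + 3 * euler_gamma ^ 2 - 3 * euler_gamma - 3 * stieltjes 1 + 1).

Definition Delta3 (x : R) : R := T3 x - main_term3 x.

(* Main.v *)
Require Import Defs.
From Stdlib Require Import Reals Arith List ZArith Lra Lia Psatz.
From Coquelicot Require Import Coquelicot.

(** Let g be Euler's constant, psi(t) = {t} - 1/2, and B = x / A for an integer
    A >= 1. The hyperbola method gives
      T3(x) = sum_{c <= A} T2(x/c) + sum_{n <= B} d(n) (floor(x/n) - A),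
    where T2 is the summatory function of the divisor function d. A second use of it
    gives T2(u) = u ln u + (2g - 1) u + Delta2(u) with |Delta2(u)| <= sqrt u + 1/4, so the
    first sum has an error of about 2 sqrt(x A). In the second sum floor(x/n) is
    x/n - 1/2 - psi(x/n), and bounding psi by 1/2 costs T2(B)/2, about (B ln B)/2. The
    remaining weighted sum of d(n) (1/n - 1/B) has to be known up to O(1/B); this follows
    from the hyperbola method as well, because the sums of psi(u/a) which appear in the
    sums of d(n) and of d(n)/n cancel in this combination. The choice A ~ y/2 with
    y = x^(1/3) (ln x)^(2/3) balances the two errors and leaves enough room for the
    lower-order terms; A = 1 and A = 2 serve for small x. *)

Open Scope R_scope.

(** * The integer part as a natural number *)

(** Literally the upper limit in [sum_le], so [fold] applies to [T3] and to the sum in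
    [stieltjes]. *)
Definition fl (x : R) : nat := Z.to_nat (Int_part x).

Lemma fl_spec (x : R) : 0 <= x -> INR (fl x) <= x < INR (fl x) + 1.
Proof.
intros Hx. unfold fl.
destruct (base_Int_part x) as [H1 H2].
assert (H : (0 <= Int_part x)%Z).
{ apply Z.lt_succ_r, lt_IZR. rewrite succ_IZR. lra. }
rewrite INR_IZR_INZ, Z2Nat.id by exact H. lra.
Qed.

Lemma le_fl (n : nat) (x : R) : 0 <= x -> (n <= fl x)%nat <-> INR n <= x.
Proof.
intros Hx. destruct (fl_spec x Hx) as [H1 H2]. split; intros H.
- apply le_INR in H. lra.
- apply Nat.lt_succ_r, INR_lt. rewrite S_INR. lra.
Qed.

Lemma fl_unique (n : nat) (x : R) : INR n <= x < INR n + 1 -> fl x = n.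
Proof.
intros [H1 H2]. pose proof (pos_INR n).
destruct (fl_spec x ltac:(lra)) as [H3 H4].
apply Nat.le_antisymm; apply Nat.lt_succ_r, INR_lt; rewrite S_INR; lra.
Qed.

Lemma fl_mono (x y : R) : 0 <= x <= y -> (fl x <= fl y)%nat.
Proof.
intros H. apply le_fl; [lra|]. destruct (fl_spec x ltac:(lra)); lra.
Qed.

(** * Finite sums and the hyperbola method *)

Fixpoint sm (f : nat -> R) (n : nat) : R :=
  match n with O => 0 | S k => sm f k + f (S k) end.

Lemma sm_sum_n_m (f : nat -> R) (n : nat) : sum_n_m f 1 n = sm f n.
Proof.
induction n as [|n IH]; [now rewrite sum_n_m_zero by lia|].
rewrite sum_n_Sm by lia. rewrite IH. reflexivity.
Qed.

Lemma sm_ext (f g : nat -> R) (n : nat) :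
  (forall k, (1 <= k <= n)%nat -> f k = g k) -> sm f n = sm g n.
Proof.
induction n as [|n IH]; intros H; simpl; [reflexivity|].
rewrite IH, H by (try intros; try apply H; lia). reflexivity.
Qed.

Lemma sm_le (f g : nat -> R) (n : nat) :
  (forall k, (1 <= k <= n)%nat -> f k <= g k) -> sm f n <= sm g n.
Proof.
induction n as [|n IH]; intros H; simpl; [lra|].
apply Rplus_le_compat; [apply IH; intros; apply H; lia | apply H; lia].
Qed.

Lemma sm_plus (f g : nat -> R) (n : nat) :
  sm (fun k => f k + g k) n = sm f n + sm g n.
Proof. induction n as [|n IH]; simpl; [ring|rewrite IH; ring]. Qed.

Lemma sm_minus (f g : nat -> R) (n : nat) :
  sm (fun k => f k - g k) n = sm f n - sm g n.
Proof. induction n as [|n IH]; simpl; [ring|rewrite IH; ring]. Qed.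

Lemma sm_scal (c : R) (f : nat -> R) (n : nat) :
  sm (fun k => c * f k) n = c * sm f n.
Proof. induction n as [|n IH]; simpl; [ring|rewrite IH; ring]. Qed.

Lemma sm_scal_r (c : R) (f : nat -> R) (n : nat) :
  sm (fun k => f k * c) n = sm f n * c.
Proof. induction n as [|n IH]; simpl; [ring|rewrite IH; ring]. Qed.

Lemma sm_const (c : R) (n : nat) : sm (fun _ => c) n = INR n * c.
Proof.
induction n as [|n IH]; [simpl; ring|]. rewrite S_INR. simpl. rewrite IH. ring.
Qed.

Lemma sm_abs (f : nat -> R) (n : nat) : Rabs (sm f n) <= sm (fun k => Rabs (f k)) n.
Proof.
induction n as [|n IH]; simpl; [rewrite Rabs_R0; lra|].
eapply Rle_trans; [apply Rabs_triang|lra].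
Qed.

Lemma sm_swap (f : nat -> nat -> R) (n m : nat) :
  sm (fun i => sm (fun j => f i j) m) n = sm (fun j => sm (fun i => f i j) n) m.
Proof.
induction n as [|n IH]; simpl.
- rewrite sm_const. ring.
- rewrite IH, <- sm_plus. reflexivity.
Qed.

Lemma sm_INR (n : nat) : sm INR n = INR n * (INR n + 1) / 2.
Proof.
induction n as [|n IH]; [simpl; lra|].
cbn [sm]. rewrite IH, S_INR. field.
Qed.

(** Telescoping: [/ sqrt (m + 1) <= 2 * (sqrt (m + 1) - sqrt m)], which is the expanded form of
    [(sqrt (m + 1) - sqrt m)^2 >= 0]. *)
Lemma sm_inv_sqrt (n : nat) :
  (1 <= n)%nat -> sm (fun k => / sqrt (INR k)) n <= 2 * sqrt (INR n) - 1.
Proof.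
induction n as [|n IH]; intros Hn; [lia|].
destruct n as [|n].
- simpl. rewrite sqrt_1, Rinv_1. lra.
- specialize (IH ltac:(lia)). cbn [sm] in *.
  assert (H : 0 < INR (S n)) by (apply lt_0_INR; lia).
  set (m := S n) in *. rewrite (S_INR m).
  pose proof (sqrt_lt_R0 _ H) as Ha.
  pose proof (sqrt_lt_R0 (INR m + 1) ltac:(lra)) as Hb.
  pose proof (sqrt_sqrt (INR m) ltac:(lra)) as Ea.
  pose proof (sqrt_sqrt (INR m + 1) ltac:(lra)) as Eb.
  assert (/ sqrt (INR m + 1) <= 2 * sqrt (INR m + 1) - 2 * sqrt (INR m)).
  { apply (Rmult_le_reg_l (sqrt (INR m + 1))); [exact Hb|].
    rewrite Rinv_r by lra. nra. }
  lra.
Qed.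

(** With constraints written as factors 0 or 1, all sums run over one fixed box and can be exchanged
    freely. *)
Definition ind_le (u v : R) : R := if Rle_dec u v then 1 else 0.

Lemma ind_le_true (u v : R) : u <= v -> ind_le u v = 1.
Proof. intros H. unfold ind_le. destruct (Rle_dec u v); [reflexivity|contradiction]. Qed.

Lemma ind_le_false (u v : R) : v < u -> ind_le u v = 0.
Proof. intros H. unfold ind_le. destruct (Rle_dec u v); [lra|reflexivity]. Qed.

Lemma ind_le_iff (u v u' v' : R) : (u <= v <-> u' <= v') -> ind_le u v = ind_le u' v'.
Proof. intros H. unfold ind_le. destruct (Rle_dec u v), (Rle_dec u' v'); tauto. Qed.

Lemma sm_trunc (f : nat -> R) (v : R) (M : nat) :
  0 <= v -> (fl v <= M)%nat -> sm (fun k => ind_le (INR k) v * f k) M = sm f (fl v).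
Proof.
intros Hv. induction M as [|M IH]; intros HM.
- replace (fl v) with O by lia. reflexivity.
- cbn [sm]. destruct (Nat.eq_dec (fl v) (S M)) as [E|NE].
  + rewrite E. cbn [sm]. rewrite ind_le_true by (apply le_fl; lia || lra).
    rewrite Rmult_1_l. f_equal. apply sm_ext. intros k Hk.
    rewrite ind_le_true by (apply le_fl; lia || lra). ring.
  + rewrite IH by lia. rewrite ind_le_false; [ring|].
    apply Rnot_le_lt. intros H. apply le_fl in H; [lia|lra].
Qed.

Lemma sm_ind (v : R) (M : nat) :
  0 <= v -> (fl v <= M)%nat -> sm (fun k => ind_le (INR k) v) M = INR (fl v).
Proof.
intros Hv HM. rewrite <- (Rmult_1_r (INR (fl v))), <- sm_const, <- (sm_trunc _ v M) by assumption.
apply sm_ext. intros; ring.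
Qed.

Lemma INR_ge1 (k : nat) : (1 <= k)%nat -> 1 <= INR k.
Proof. intros H. apply le_INR in H. exact H. Qed.

Lemma div_le_iff (a b u : R) : 0 < a -> a * b <= u <-> b <= u / a.
Proof.
intros Ha. split; intros H.
- apply (Rmult_le_reg_l a); [lra|]. replace (a * (u / a)) with u by (field; lra). lra.
- apply (Rmult_le_compat_l a) in H; [|lra].
  replace (a * (u / a)) with u in H by (field; lra). lra.
Qed.

Lemma div_nonneg (u : R) (k : nat) : 0 <= u -> (1 <= k)%nat -> 0 <= u / INR k <= u.
Proof.
intros Hu Hk. pose proof (INR_ge1 k Hk).
split; [apply Rmult_le_pos; [lra|left; apply Rinv_0_lt_compat; lra]|].
apply Rle_div_l; nra.
Qed.

(* The sum of f (ab) over the pairs of positive integers with ab <= u, that is,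
   of d(n) f(n) over n <= u. *)
Definition dsum (f : R -> R) (u : R) : R :=
  sm (fun a => sm (fun b => f (INR a * INR b)) (fl (u / INR a))) (fl u).

(** For [a, b >= 1] the condition [ab <= u] forces both factors into the box. This form is symmetric
    in the two variables, unlike the definition of [dsum]. *)
Lemma dsum_box (f : R -> R) (u : R) (M : nat) :
  0 <= u -> (fl u <= M)%nat ->
  sm (fun a => sm (fun b => ind_le (INR a * INR b) u * f (INR a * INR b)) M) M = dsum f u.
Proof.
intros Hu HM. unfold dsum.
rewrite <- (sm_trunc _ u M) by assumption. apply sm_ext. intros a Ha.
pose proof (INR_ge1 a ltac:(lia)) as Ha1.
pose proof (div_nonneg u a Hu ltac:(lia)) as Hd.
assert (Hfl : (fl (u / INR a) <= M)%nat) by (pose proof (fl_mono (u / INR a) u ltac:(lra)); lia).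
destruct (Rle_dec (INR a) u) as [Hau|Hau].
- rewrite ind_le_true, Rmult_1_l by lra. rewrite <- (sm_trunc _ (u / INR a) M) by lra || assumption.
  apply sm_ext. intros b Hb. f_equal. apply ind_le_iff. apply div_le_iff. lra.
- rewrite ind_le_false, Rmult_0_l by lra.
  rewrite <- (Rmult_0_r (INR M)), <- sm_const. apply sm_ext. intros b Hb.
  pose proof (INR_ge1 b ltac:(lia)). rewrite ind_le_false by nra. ring.
Qed.

(** Dirichlet's hyperbola method: a pair with [ab <= u] has [a <= N] or [b <= N], and the pairs with
    both, counted twice, are exactly the square of side [N]. *)
Lemma dsum_hyperbola (f : R -> R) (u : R) (N : nat) :
  0 <= u -> INR N <= sqrt u < INR N + 1 ->
  dsum f u = 2 * sm (fun a => sm (fun b => f (INR a * INR b)) (fl (u / INR a))) N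
             - sm (fun a => sm (fun b => f (INR a * INR b)) N) N.
Proof.
intros Hu [HN1 HN2].
pose proof (sqrt_sqrt u Hu) as Es. pose proof (pos_INR N) as HN0.
pose proof (pos_INR (fl u)) as Hp. destruct (fl_spec u Hu) as [Hf1 Hf2].
assert (HNM : (N <= fl u)%nat).
{ apply le_fl; [lra|]. destruct N as [|N]; [simpl; lra|].
  pose proof (INR_ge1 (S N) ltac:(lia)). nra. }
rewrite <- (dsum_box f u (fl u)) by lia || lra.
set (M := fl u) in *.
set (i := fun a => ind_le (INR a) (INR N)).
set (g := fun a b => ind_le (INR a * INR b) u * f (INR a * INR b)).
assert (HfN : fl (INR N) = N) by (apply fl_unique; lra).
(* Inclusion-exclusion, term by term. The two cases left after [ring] are the square, where
   [ab <= N^2 <= u], and [a, b > N], where [ab >= (N + 1)^2 > u]. *)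
rewrite (sm_ext _ (fun a => sm (fun b => i a * g a b + i b * g b a
    - i a * (i b * f (INR a * INR b))) M)).
2:{ intros a Ha. apply sm_ext. intros b Hb. unfold g, i.
    rewrite (Rmult_comm (INR b) (INR a)).
    destruct (Nat.le_gt_cases a N) as [H1|H1], (Nat.le_gt_cases b N) as [H2|H2];
    apply le_INR in H1; apply le_INR in H2; try rewrite S_INR in H1; try rewrite S_INR in H2;
    repeat first [rewrite (ind_le_true (INR a)) by lra | rewrite (ind_le_true (INR b)) by lra |
      rewrite (ind_le_false (INR a)) by lra | rewrite (ind_le_false (INR b)) by lra]; try ring.
    - pose proof (pos_INR a); pose proof (pos_INR b). rewrite ind_le_true by nra. ring.
    - rewrite ind_le_false by nra. ring. }
rewrite (sm_ext _ (fun a => i a * sm (g a) M + sm (fun b => i b * g b a) M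
    - i a * sm (fun b => i b * f (INR a * INR b)) M)).
2:{ intros a Ha. rewrite <- !sm_scal, <- sm_plus, <- sm_minus. reflexivity. }
rewrite sm_minus, sm_plus, (sm_swap (fun a b => i b * g b a)).
rewrite (sm_ext (fun j => sm (fun a => i j * g j a) M) (fun j => i j * sm (g j) M))
  by (intros; apply sm_scal).
unfold i at 1 2 3. rewrite !sm_trunc by (rewrite ?HfN; lia || lra). rewrite HfN.
assert (HA : forall a, (1 <= a <= N)%nat ->
  sm (g a) M = sm (fun b => f (INR a * INR b)) (fl (u / INR a))).
{ intros a Ha. pose proof (INR_ge1 a ltac:(lia)).
  pose proof (div_nonneg u a Hu ltac:(lia)).
  rewrite <- (sm_trunc _ (u / INR a) M) by (try apply fl_mono; lra).
  apply sm_ext. intros b Hb. unfold g. f_equal. apply ind_le_iff. apply div_le_iff. lra. }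
rewrite (sm_ext (fun k => sm (g k) M) _ N HA).
assert (HB : forall a, sm (fun b => i b * f (INR a * INR b)) M = sm (fun b => f (INR a * INR b)) N).
{ intros a. unfold i. rewrite sm_trunc by (rewrite ?HfN; lia || lra). rewrite HfN. reflexivity. }
rewrite (sm_ext (fun k => sm (fun b => i b * f (INR k * INR b)) M) _ N (fun k _ => HB k)).
ring.
Qed.

(** * Counting triples *)

(** A bridge from the length of the filtered list in [d3] to nested sums [sm]. *)
Definition lsum {A : Type} (f : A -> R) (l : list A) : R :=
  fold_right (fun a s => f a + s) 0 l.

Lemma lsum_app {A : Type} (f : A -> R) (l1 l2 : list A) :
  lsum f (l1 ++ l2) = lsum f l1 + lsum f l2.
Proof. induction l1 as [|a l IH]; simpl; [ring|rewrite IH; ring]. Qed.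

Lemma lsum_map {A B : Type} (g : A -> B) (f : B -> R) (l : list A) :
  lsum f (map g l) = lsum (fun a => f (g a)) l.
Proof. induction l as [|a l IH]; simpl; [reflexivity|rewrite IH; reflexivity]. Qed.

Lemma lsum_prod {A B : Type} (f : A * B -> R) (l : list A) (m : list B) :
  lsum f (list_prod l m) = lsum (fun a => lsum (fun b => f (a, b)) m) l.
Proof.
induction l as [|a l IH]; simpl; [reflexivity|].
rewrite lsum_app, lsum_map, IH. reflexivity.
Qed.

Lemma lsum_seq (f : nat -> R) (n : nat) : lsum f (seq 1 n) = sm f n.
Proof.
induction n as [|n IH]; [reflexivity|].
rewrite seq_S, lsum_app, IH. simpl. ring.
Qed.

Lemma length_filter_lsum {A : Type} (p : A -> bool) (l : list A) :
  INR (length (filter p l)) = lsum (fun a => if p a then 1 else 0) l.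
Proof.
induction l as [|a l IH]; [reflexivity|].
simpl filter. simpl lsum. destruct (p a); rewrite <- IH; [simpl length; rewrite S_INR|]; ring.
Qed.

Lemma sm_extend (f : nat -> R) (n M : nat) :
  (n <= M)%nat -> (forall k, (n < k <= M)%nat -> f k = 0) -> sm f M = sm f n.
Proof.
intros Hn. induction M as [|M IH]; intros H.
- replace n with O by lia. reflexivity.
- destruct (Nat.eq_dec n (S M)) as [->|NE]; [reflexivity|].
  cbn [sm]. rewrite H, IH by (try intros; try apply H; lia). ring.
Qed.

Lemma sm_zero (f : nat -> R) (n : nat) :
  (forall k, (1 <= k <= n)%nat -> f k = 0) -> sm f n = 0.
Proof. intros H. rewrite (sm_extend f 0 n) by (try apply H; lia). reflexivity. Qed.

Lemma sm_eqb (m M : nat) :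
  (1 <= m)%nat -> sm (fun n => if Nat.eqb m n then 1 else 0) M = ind_le (INR m) (INR M).
Proof.
intros Hm. induction M as [|M IH].
- simpl sm. rewrite ind_le_false; [reflexivity|]. apply lt_0_INR. lia.
- cbn [sm]. rewrite IH. destruct (Nat.eqb_spec m (S M)) as [->|NE].
  + rewrite ind_le_false, ind_le_true by (try apply lt_INR; lia || lra). ring.
  + rewrite Rplus_0_r. apply ind_le_iff. split; intros H; apply INR_le in H; apply le_INR; lia.
Qed.

(** Factors of a positive [n] do not exceed [n], so the box may be enlarged to a side [M]
    independent of [n]. This permits exchanging the sum over [n] with the sums over the factors. *)
Lemma d3_box (n M : nat) :
  (1 <= n <= M)%nat ->
  INR (d3 n) = sm (fun a => sm (fun b => sm (fun c =>
     if Nat.eqb (a * b * c) n then 1 else 0) M) M) M.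
Proof.
intros Hn. unfold d3. rewrite length_filter_lsum, !lsum_prod. simpl fst. simpl snd.
rewrite lsum_seq.
assert (Z : forall a b c, (a * b * c <> n)%nat ->
  (if Nat.eqb (a * b * c) n then 1 else 0) = 0).
{ intros a b c H. destruct (Nat.eqb_spec (a * b * c) n); [contradiction|reflexivity]. }
rewrite (sm_extend _ n M).
2: lia.
2:{ intros a Ha. apply sm_zero; intros b Hb. apply sm_zero; intros c Hc. apply Z.
    assert (1 <= b * c)%nat by nia. rewrite <- Nat.mul_assoc. nia. }
apply sm_ext. intros a Ha. rewrite lsum_seq. rewrite (sm_extend _ n M).
2: lia.
2:{ intros b Hb. apply sm_zero; intros c Hc. apply Z.
    assert (1 <= a * c)%nat by nia. rewrite (Nat.mul_comm a b), <- Nat.mul_assoc. nia. }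
apply sm_ext. intros b Hb. rewrite lsum_seq. rewrite (sm_extend _ n M).
2: lia.
2:{ intros c Hc. apply Z. assert (1 <= a * b)%nat by nia. nia. }
reflexivity.
Qed.

Lemma T3_box (x : R) :
  0 <= x ->
  T3 x = sm (fun c => sm (fun a => sm (fun b =>
     ind_le (INR a * INR b * INR c) x) (fl x)) (fl x)) (fl x).
Proof.
intros Hx. unfold T3, sum_le. fold (fl x). rewrite sm_sum_n_m.
set (M := fl x). destruct (fl_spec x Hx) as [Hf1 Hf2]. fold M in Hf1, Hf2.
rewrite (sm_ext _ _ M (fun n Hn => d3_box n M Hn)).
(* Three exchanges bring the sum over [n] innermost, where [sm_eqb] evaluates it: each triple is
   counted once if its product is at most [M]. *)
rewrite sm_swap. apply sm_ext; intros c Hc.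
rewrite sm_swap. apply sm_ext; intros a Ha.
rewrite sm_swap. apply sm_ext; intros b Hb.
assert (1 <= c * a)%nat by nia.
rewrite sm_eqb by nia. apply ind_le_iff.
replace (INR a * INR b * INR c) with (INR (c * a * b)) by (rewrite !mult_INR; ring).
split; [lra|]. intros H1. apply le_INR. apply le_fl; lra.
Qed.

(* Triples abc <= x with c <= A, then those with c > A: the latter have ab <= x / A. *)
Lemma T3_split (x : R) (A : nat) :
  0 <= x -> (1 <= A)%nat -> INR A <= x ->
  T3 x = sm (fun c => dsum (fun _ => 1) (x / INR c)) A
         + dsum (fun t => INR (fl (x / t)) - INR A) (x / INR A).
Proof.
intros Hx HA HAx. rewrite T3_box by exact Hx. set (M := fl x).
pose proof (INR_ge1 A HA) as HA1.
destruct (fl_spec x Hx) as [Hf1 Hf2]. fold M in Hf1, Hf2.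
assert (HAM : (A <= M)%nat) by (apply le_fl; lra).
assert (HfA : fl (INR A) = A) by (apply fl_unique; lra).
set (i := fun c => ind_le (INR c) (INR A)).
(* Splits by [1 = i c + (1 - i c)], with [i] the indicator of [c <= A]. *)
rewrite (sm_ext _ (fun c => i c * sm (fun a => sm (fun b => ind_le (INR a * INR b * INR c) x) M) M
   + (sm (fun a => sm (fun b => (1 - i c) * ind_le (INR a * INR b * INR c) x) M) M))).
2:{ intros c Hc.
    rewrite (sm_ext (fun a => sm (fun b => (1 - i c) * _) M)
       (fun a => (1 - i c) * sm (fun b => ind_le (INR a * INR b * INR c) x) M))
      by (intros; apply sm_scal).
    rewrite sm_scal. ring. }
rewrite sm_plus. f_equal.
- unfold i. rewrite sm_trunc by (rewrite ?HfA; lia || lra). rewrite HfA.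
  apply sm_ext. intros c Hc.
  pose proof (INR_ge1 c ltac:(lia)). pose proof (div_nonneg x c Hx ltac:(lia)).
  rewrite <- (dsum_box _ _ M) by (try apply fl_mono; lra).
  apply sm_ext; intros a Ha. apply sm_ext; intros b Hb. rewrite Rmult_1_r. apply ind_le_iff.
  rewrite (Rmult_comm _ (INR c)). apply div_le_iff. lra.
- pose proof (div_nonneg x A Hx HA).
  rewrite <- (dsum_box _ _ M) by (try apply fl_mono; lra).
  rewrite sm_swap. apply sm_ext; intros a Ha. rewrite sm_swap. apply sm_ext; intros b Hb.
  pose proof (INR_ge1 a ltac:(lia)) as Ha1. pose proof (INR_ge1 b ltac:(lia)) as Hb1.
  assert (Hab : 1 <= INR a * INR b) by nra.
  set (t := INR a * INR b) in *.
  assert (Hxt : 0 <= x / t <= x).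
  { split; [apply Rmult_le_pos; [lra|left; apply Rinv_0_lt_compat; lra]|].
    apply Rle_div_l; nra. }
  destruct (Rle_dec t (x / INR A)) as [Ht|Ht].
  + rewrite ind_le_true, Rmult_1_l by exact Ht.
    assert (HAt : INR A <= x / t) by (apply div_le_iff; [lra|]; apply div_le_iff in Ht; lra).
    (* Here [A <= x / t], so the [c] with [A < c <= x / t] number [fl (x / t) - A]. *)
    rewrite (sm_ext _ (fun c => ind_le (INR c) (x / t) - i c * 1)).
    2:{ intros c Hc. unfold i.
        rewrite (ind_le_iff (t * INR c) x (INR c) (x / t)) by (apply div_le_iff; lra).
        destruct (Rle_dec (INR c) (INR A)).
        - rewrite !ind_le_true by lra. ring.
        - rewrite (ind_le_false (INR c) (INR A)) by lra. ring. }
    rewrite sm_minus, sm_ind by (try apply fl_mono; lra).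
    unfold i. rewrite sm_trunc by (rewrite ?HfA; lia || lra). rewrite HfA, sm_const. ring.
  (* Here [t > x / A]: a [c <= A] is removed by [1 - i c], and a [c > A] gives [t * c > x]. *)
  + rewrite ind_le_false, Rmult_0_l by lra. apply sm_zero. intros c Hc. unfold i.
    destruct (Rle_dec (INR c) (INR A)) as [Hc'|Hc'].
    * rewrite ind_le_true by lra. ring.
    * rewrite (ind_le_false (t * INR c)); [ring|]. apply Rnot_le_lt. intros H0.
      apply Ht. apply (div_le_iff (INR A) t x); [lra|].
      apply Rle_trans with (t * INR c); [|exact H0].
      rewrite Rmult_comm. apply Rmult_le_compat_l; lra.
Qed.

(** * Explicit Euler-Maclaurin remainders *)

Lemma mvt (f df : R -> R) (a b : R) :
  a <= b -> (forall t, a <= t <= b -> is_derive f t (df t)) ->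
  exists c, a <= c <= b /\ f b - f a = df c * (b - a).
Proof.
intros Hab Hd.
destruct (MVT_gen f a b df) as [c [Hc E]].
- intros t Ht. rewrite Rmin_left, Rmax_right in Ht by lra. apply Hd. lra.
- intros t Ht. rewrite Rmin_left, Rmax_right in Ht by lra.
  apply continuity_pt_filterlim. apply (ex_derive_continuous f t). eexists. apply Hd, Ht.
- rewrite Rmin_left, Rmax_right in Hc by lra. exists c. split; assumption.
Qed.

(** The pieces on [[n, n + 1]] glue to a continuous decreasing function that tends to 0 along the
    integers, hence is nonnegative. The remainder bounds below are obtained by exhibiting such
    functions. *)
Lemma piecewise_decreasing_nonneg (f df : nat -> R -> R) :
  (forall n y, (1 <= n)%nat -> INR n <= y <= INR n + 1 ->
     is_derive (f n) y (df n y) /\ df n y <= 0) ->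
  (forall n, (1 <= n)%nat -> f n (INR n + 1) = f (S n) (INR n + 1)) ->
  is_lim_seq (fun n => f n (INR n)) 0 ->
  forall n y, (1 <= n)%nat -> INR n <= y <= INR n + 1 -> 0 <= f n y.
Proof.
intros Hd Hc Hl.
assert (Hdec : forall n y, (1 <= n)%nat -> INR n <= y <= INR n + 1 ->
  f (S n) (INR (S n)) <= f n y).
{ intros n y Hn Hy. rewrite S_INR, <- Hc by exact Hn.
  destruct (mvt (f n) (df n) y (INR n + 1) ltac:(lra)) as [c [Hcc E]].
  - intros t Ht. apply (Hd n t Hn). lra.
  - pose proof (proj2 (Hd n c Hn ltac:(lra))). nra. }
intros n y Hn Hy. apply Rle_trans with (2 := Hdec n y Hn Hy).
apply (is_lim_seq_incr_n _ (S n)) in Hl.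
apply (is_lim_seq_decr_compare _ _ Hl) with (n := O). intros k.
rewrite (Nat.add_succ_l k). apply Hdec; [lia|lra].
Qed.

(** * Harmonic sums and the limits defining the constants *)

Definition harm (n : nat) : R := sm (fun k => / INR k) n.
Definition lharm (n : nat) : R := sm (fun k => ln (INR k) / INR k) n.

Lemma ln_le_sub1 (t : R) : 0 < t -> ln t <= t - 1.
Proof. intros Ht. pose proof (exp_ineq1_le (ln t)) as H. rewrite exp_ln in H by exact Ht. lra. Qed.

Lemma ln_ratio_le (a b : R) : 0 < a -> 0 < b -> ln b - ln a <= (b - a) / a.
Proof.
intros Ha Hb. rewrite <- ln_div by assumption.
eapply Rle_trans; [apply ln_le_sub1; apply Rdiv_lt_0_compat; assumption|].
right. field. lra.
Qed.

Lemma ln3_ge1 : 1 <= ln 3.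
Proof. rewrite <- (ln_exp 1). apply ln_le; [apply exp_pos|apply exp_le_3]. Qed.

Lemma ln_nonneg (t : R) : 1 <= t -> 0 <= ln t.
Proof. intros Ht. rewrite <- ln_1. apply ln_le; lra. Qed.

(** From [ln b - ln a <= (b - a) / a] follows [a * ln b <= a * ln a + (b - a)], and
    [b - a <= (b - a) * ln a] since [ln a >= 1]. *)
Lemma ln_div_decr (a b : R) : 0 < a <= b -> 1 <= ln a -> ln b / b <= ln a / a.
Proof.
intros H Ha. pose proof (ln_ratio_le a b ltac:(lra) ltac:(lra)) as H1.
apply (Rmult_le_compat_l a) in H1; [|lra].
replace (a * ((b - a) / a)) with (b - a) in H1 by (field; lra).
apply Rle_div_l; [lra|]. replace (ln a / a * b) with (ln a * b / a) by (field; lra).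
apply Rle_div_r; [lra|]. nra.
Qed.

Lemma ln_div_incr (a b : R) : 0 < a <= b -> ln b <= 1 -> ln a / a <= ln b / b.
Proof.
intros H Hb. pose proof (ln_ratio_le b a ltac:(lra) ltac:(lra)) as H1.
apply (Rmult_le_compat_l b) in H1; [|lra].
replace (b * ((a - b) / b)) with (a - b) in H1 by (field; lra).
apply Rle_div_l; [lra|]. replace (ln b / b * a) with (ln b * a / b) by (field; lra).
apply Rle_div_r; [lra|]. nra.
Qed.

Lemma ex_finite_lim_seq_shift (u : nat -> R) (k : nat) :
  ex_finite_lim_seq (fun n => u (n + k)%nat) -> ex_finite_lim_seq u.
Proof. intros [l Hl]. exists l. apply (is_lim_seq_incr_n _ k). exact Hl. Qed.

(** The sequence decreases and is nonnegative, because [ln (n + 1) <= harm n]. *)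
Lemma euler_gamma_lim : is_lim_seq (fun n => harm n - ln (INR n)) euler_gamma.
Proof.
assert (Hex : ex_finite_lim_seq (fun n => harm n - ln (INR n))).
(* The term at 0, with the default value [ln 0 = 0], breaks monotonicity. *)
{ apply (ex_finite_lim_seq_shift _ 1). apply ex_finite_lim_seq_decr with 0; intros n;
  rewrite Nat.add_1_r.
  - rewrite Nat.add_1_r. unfold harm. cbn [sm]. rewrite (S_INR (S n)).
    pose proof (INR_ge1 (S n) ltac:(lia)) as H. set (m := INR (S n)) in *.
    pose proof (ln_ratio_le (m + 1) m ltac:(lra) ltac:(lra)) as H1.
    replace ((m - (m + 1)) / (m + 1)) with (- / (m + 1)) in H1 by (field; lra). lra.
  - assert (H : ln (INR (S n) + 1) <= harm (S n)).
    { induction n as [|n IH].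
      - unfold harm. simpl. pose proof (ln_le_sub1 2 ltac:(lra)).
        replace (1 + 1) with 2 by ring. lra.
      - unfold harm in *. cbn [sm] in *. rewrite (S_INR (S n)).
        pose proof (INR_ge1 (S n) ltac:(lia)) as H. set (m := INR (S n)) in *.
        pose proof (ln_ratio_le (m + 1) (m + 1 + 1) ltac:(lra) ltac:(lra)) as H1.
        replace ((m + 1 + 1 - (m + 1)) / (m + 1)) with (/ (m + 1)) in H1 by (field; lra).
        lra. }
    pose proof (INR_ge1 (S n) ltac:(lia)).
    pose proof (ln_le (INR (S n)) (INR (S n) + 1) ltac:(lra) ltac:(lra)). lra. }
destruct Hex as [l Hl].
unfold euler_gamma.
rewrite (Lim_seq_ext (fun n => sum_n_m (fun k => 1 / INR k) 1 n - ln (INR n))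
  (fun n => harm n - ln (INR n))); [rewrite (is_lim_seq_unique _ _ Hl); exact Hl|].
intros n. rewrite sm_sum_n_m. f_equal. apply sm_ext. intros. apply Rdiv_1_l.
Qed.

Lemma half_ln_sq_diff (a : R) :
  0 < a -> exists c, a <= c <= a + 1 /\ ln (a + 1) ^ 2 / 2 - ln a ^ 2 / 2 = ln c / c.
Proof.
intros Ha. destruct (mvt (fun t => ln t ^ 2 / 2) (fun t => ln t / t) a (a + 1)) as [c [Hc E]].
- lra.
- intros t Ht. auto_derive; [lra|]. field. lra.
- exists c. split; [exact Hc|]. rewrite E. ring.
Qed.

(** Integral comparison again, but [ln t / t] decreases only from [e] on, hence the shift by 3. The
    lower bound comes from the increasing companion sequence with [ln (n + 1)] in place of
    [ln n]. *)
Lemma lharm_ex_lim : ex_finite_lim_seq (fun n => lharm n - ln (INR n) ^ 2 / 2).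
Proof.
assert (H3 : forall n, 3 <= INR (n + 3)).
{ intros n. rewrite plus_INR. simpl. pose proof (pos_INR n). lra. }
assert (Hl1 : forall t, 3 <= t -> 1 <= ln t).
{ intros t Ht. pose proof ln3_ge1. pose proof (ln_le 3 t ltac:(lra) Ht). lra. }
apply (ex_finite_lim_seq_shift _ 3).
apply ex_finite_lim_seq_decr with (lharm 3 - ln (INR 3 + 1) ^ 2 / 2); intros n.
- rewrite Nat.add_succ_l. unfold lharm. cbn [sm]. rewrite S_INR.
  specialize (H3 n). set (m := INR (n + 3)) in *.
  destruct (half_ln_sq_diff m ltac:(lra)) as [c [Hc E]].
  pose proof (ln_div_decr c (m + 1) ltac:(lra) (Hl1 c ltac:(lra))). lra.
- apply Rle_trans with (lharm (n + 3) - ln (INR (n + 3) + 1) ^ 2 / 2).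
  + induction n as [|n IH]; [apply Rle_refl|]. apply Rle_trans with (1 := IH).
    rewrite Nat.add_succ_l. unfold lharm. cbn [sm]. rewrite S_INR.
    specialize (H3 n). set (m := INR (n + 3)) in *.
    destruct (half_ln_sq_diff (m + 1) ltac:(lra)) as [c [Hc E]].
    pose proof (ln_div_decr (m + 1) c ltac:(lra) (Hl1 (m + 1) ltac:(lra))). lra.
  + specialize (H3 n). set (m := INR (n + 3)) in *.
    pose proof (ln_le m (m + 1) ltac:(lra) ltac:(lra)). pose proof (Hl1 m H3). nra.
Qed.

Lemma ln_div_lim : is_lim_seq (fun n => ln (INR n) / INR n) 0.
Proof.
apply (filterlim_comp _ _ _ INR (fun y => ln y / y) _ (Rbar_locally p_infty)).
- apply is_lim_seq_INR.
- apply is_lim_div_ln_p.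
Qed.

Lemma fl_filterlim : filterlim fl (Rbar_locally p_infty) eventually.
Proof.
intros P [N HN]. exists (INR N). intros x Hx. apply HN.
pose proof (pos_INR N). apply le_fl; lra.
Qed.

Lemma is_lim_comp_fl (u : nat -> R) (l : R) :
  is_lim_seq u l -> is_lim (fun x => u (fl x)) p_infty l.
Proof.
intros H. apply (filterlim_comp _ _ _ fl u (Rbar_locally' p_infty) eventually _).
- exact fl_filterlim.
- exact H.
Qed.

(** [stieltjes] is a limit over the reals. For [n <= x < n + 1] the sum is [lharm n], and [ln x]
    lies between [ln n] and [ln (n + 1)], which squeezes the real limit between two sequences with
    the same limit. *)
Lemma stieltjes1_lim : is_lim_seq (fun n => lharm n - ln (INR n) ^ 2 / 2) (stieltjes 1).
Proof.
destruct lharm_ex_lim as [l Hl].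
enough (H : is_lim (fun x => sum_le (fun n => ln (INR n) ^ 1 / INR n) x
                      - ln x ^ (1 + 1) / INR (1 + 1)) p_infty l).
{ unfold stieltjes. rewrite (is_lim_unique _ _ _ H). exact Hl. }
(* The lower function is [lharm n - ln (n + 1)^2 / 2], written through [n + 1] so that it is a
   shifted sequence. *)
apply is_lim_le_le_loc with
  (f := fun x => lharm (S (fl x)) - ln (INR (S (fl x))) ^ 2 / 2
           - ln (INR (S (fl x))) / INR (S (fl x)))
  (g := fun x => lharm (fl x) - ln (INR (fl x)) ^ 2 / 2).
- exists 1. intros x Hx. unfold sum_le. fold (fl x). rewrite sm_sum_n_m.
  rewrite (sm_ext _ (fun k => ln (INR k) / INR k)) by (intros; rewrite pow_1; reflexivity).
  fold (lharm (fl x)). replace (INR (1 + 1)) with 2 by reflexivity. change (1 + 1)%nat with 2%nat.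
  destruct (fl_spec x ltac:(lra)) as [H1 H2].
  assert (H3 : 1 <= INR (fl x)) by (apply INR_ge1, le_fl; simpl; lra).
  unfold lharm. cbn [sm]. fold (lharm (fl x)). rewrite S_INR.
  pose proof (ln_nonneg _ H3).
  pose proof (ln_le (INR (fl x)) x ltac:(lra) ltac:(lra)).
  pose proof (ln_le x (INR (fl x) + 1) ltac:(lra) ltac:(lra)).
  split; nra.
- apply (is_lim_comp_fl (fun n => lharm (S n) - ln (INR (S n)) ^ 2 / 2
    - ln (INR (S n)) / INR (S n))).
  apply (is_lim_seq_incr_1 (fun n => lharm n - ln (INR n) ^ 2 / 2 - ln (INR n) / INR n)).
  replace (Finite l) with (Finite (l - 0)) by (f_equal; ring).
  apply is_lim_seq_minus'; [exact Hl|apply ln_div_lim].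
- apply (is_lim_comp_fl _ _ Hl).
Qed.

(* Euler-Maclaurin remainders of [harm n] and [lharm n] at the real points y in
   [n, n + 1]; there [y - n - 1/2] is {y} - 1/2, also at y = n + 1 by continuity. *)
Definition eps (n : nat) (y : R) : R :=
  harm n - ln y - euler_gamma + (y - INR n - 1 / 2) / y.

Definition leps (n : nat) (y : R) : R :=
  lharm n - ln y ^ 2 / 2 - stieltjes 1 + (y - INR n - 1 / 2) * ln y / y.

(* This combination has derivative 2 eps / y, so it is as small as eps. *)
Definition ceps (n : nat) (y : R) : R := 2 * ln y * eps n y - 2 * leps n y - 2 * eps n y.

Lemma eps_derive (n : nat) (y : R) :
  0 < y -> is_derive (eps n) y (- (y - INR n - 1 / 2) / y ^ 2).
Proof. intros Hy. unfold eps. auto_derive; [lra|]. field. lra. Qed.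

Lemma ceps_derive (n : nat) (y : R) : 0 < y -> is_derive (ceps n) y (2 * eps n y / y).
Proof. intros Hy. unfold ceps, leps, eps. auto_derive; [lra|]. field. lra. Qed.

(** Continuity at the integers: the new term [1 / (n + 1)] makes up for the jump of the sawtooth
    from [1/2] to [-1/2]. *)
Lemma eps_succ (n : nat) : eps n (INR n + 1) = eps (S n) (INR n + 1).
Proof.
unfold eps, harm. cbn [sm]. rewrite S_INR. field. pose proof (pos_INR n). lra.
Qed.

Lemma ceps_succ (n : nat) : ceps n (INR n + 1) = ceps (S n) (INR n + 1).
Proof.
unfold ceps. rewrite eps_succ. unfold leps, lharm. cbn [sm]. rewrite S_INR. field.
pose proof (pos_INR n). lra.
Qed.

Lemma inv_INR_lim : is_lim_seq (fun n => / INR n) 0.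
Proof.
replace (Finite 0) with (Rbar_inv p_infty) by reflexivity.
apply is_lim_seq_inv; [apply is_lim_seq_INR|discriminate].
Qed.

Lemma inv_INR_sq_lim (c : R) : is_lim_seq (fun n => c / INR n ^ 2) 0.
Proof.
apply is_lim_seq_ext with (fun n => c * (/ INR n * / INR n)).
- intros n. unfold Rdiv. rewrite <- pow_inv. simpl. ring.
- replace (Finite 0) with (Finite (c * (0 * 0))) by (f_equal; ring).
  apply is_lim_seq_mult'; [apply is_lim_seq_const|].
  apply is_lim_seq_mult'; apply inv_INR_lim.
Qed.

Lemma eps_lim : is_lim_seq (fun n => eps n (INR n)) 0.
Proof.
apply is_lim_seq_ext with
  (fun n => harm n - ln (INR n) - euler_gamma + (- (1 / 2)) * / INR n).
- intros n. unfold eps, Rdiv. ring.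
- replace (Finite 0) with (Finite (euler_gamma - euler_gamma + (- (1 / 2)) * 0))
    by (f_equal; ring).
  apply is_lim_seq_plus'.
  + apply is_lim_seq_minus'; [apply euler_gamma_lim|apply is_lim_seq_const].
  + apply is_lim_seq_mult'; [apply is_lim_seq_const|apply inv_INR_lim].
Qed.

Lemma leps_lim : is_lim_seq (fun n => leps n (INR n)) 0.
Proof.
apply is_lim_seq_ext with
  (fun n => lharm n - ln (INR n) ^ 2 / 2 - stieltjes 1 + (- (1 / 2)) * (ln (INR n) / INR n)).
- intros n. unfold leps, Rdiv. ring.
- replace (Finite 0) with (Finite (stieltjes 1 - stieltjes 1 + (- (1 / 2)) * 0))
    by (f_equal; ring).
  apply is_lim_seq_plus'.
  + apply is_lim_seq_minus'; [apply stieltjes1_lim|apply is_lim_seq_const].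
  + apply is_lim_seq_mult'; [apply is_lim_seq_const|apply ln_div_lim].
Qed.

(** Integration by parts in disguise: [eps + Q / y^2] and [(1/8 - Q) / y^2 - eps] have derivatives
    [-2 Q / y^3] and [-2 (1/8 - Q) / y^3], both at most 0, and tend to 0. *)
Lemma eps_bound (n : nat) (y : R) :
  (1 <= n)%nat -> INR n <= y <= INR n + 1 -> Rabs (eps n y) <= / (8 * y ^ 2).
Proof.
intros Hn Hy. pose proof (INR_ge1 n Hn) as Hn1.
(* [q^2 / 2] is an antiderivative of [q = {y} - 1/2] with values in [0, 1/8]. *)
set (Q := fun n y => (y - INR n - 1 / 2) ^ 2 / 2).
assert (HQ : forall n y, INR n <= y <= INR n + 1 -> 0 <= Q n y <= / 8).
{ intros m t Ht. unfold Q. set (q := t - INR m - 1 / 2).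
  assert (-1 / 2 <= q <= 1 / 2) by (unfold q; lra).
  pose proof (pow2_ge_0 q). assert (q ^ 2 <= 1 / 4) by nra. lra. }
assert (Hc : forall m, Q m (INR m + 1) = Q (S m) (INR m + 1)).
{ intros m. unfold Q. rewrite S_INR. field. }
assert (HQn : forall m, Q m (INR m) = / 8) by (intros m; unfold Q; field).
assert (H1 : 0 <= eps n y + Q n y / y ^ 2).
{ apply (piecewise_decreasing_nonneg (fun n y => eps n y + Q n y / y ^ 2)
     (fun n y => - (2 * Q n y / y ^ 3))); [| | |exact Hn|exact Hy].
  - intros m t Hm Ht. pose proof (INR_ge1 m Hm). split.
    + replace (- (2 * Q m t / t ^ 3)) with
        (- (t - INR m - 1 / 2) / t ^ 2 + ((t - INR m - 1 / 2) / t ^ 2 - 2 * Q m t / t ^ 3)) by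
        (field; lra).
      apply (is_derive_plus (eps m)); [apply eps_derive; lra|].
      unfold Q. auto_derive; [nra|]. field. lra.
    + pose proof (HQ m t Ht). assert (0 < / t ^ 3) by (apply Rinv_0_lt_compat, pow_lt; lra).
      unfold Rdiv. nra.
  - intros m Hm. rewrite eps_succ, Hc. reflexivity.
  - apply is_lim_seq_ext with (fun k => eps k (INR k) + / 8 / INR k ^ 2).
    + intros k. rewrite HQn. reflexivity.
    + replace (Finite 0) with (Finite (0 + 0)) by (f_equal; ring).
      apply is_lim_seq_plus'; [apply eps_lim|apply inv_INR_sq_lim]. }
assert (H2 : 0 <= (/ 8 - Q n y) / y ^ 2 - eps n y).
{ apply (piecewise_decreasing_nonneg (fun n y => (/ 8 - Q n y) / y ^ 2 - eps n y)
     (fun n y => - (2 * (/ 8 - Q n y) / y ^ 3))); [| | |exact Hn|exact Hy].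
  - intros m t Hm Ht. pose proof (INR_ge1 m Hm). split.
    + replace (- (2 * (/ 8 - Q m t) / t ^ 3)) with
        ((- (t - INR m - 1 / 2) / t ^ 2 - 2 * (/ 8 - Q m t) / t ^ 3)
         - (- (t - INR m - 1 / 2) / t ^ 2)) by (field; lra).
      apply (is_derive_minus (fun t => (/ 8 - Q m t) / t ^ 2)); [|apply eps_derive; lra].
      unfold Q. auto_derive; [nra|]. field. lra.
    + pose proof (HQ m t Ht). assert (0 < / t ^ 3) by (apply Rinv_0_lt_compat, pow_lt; lra).
      unfold Rdiv. nra.
  - intros m Hm. rewrite eps_succ, Hc. reflexivity.
  - apply is_lim_seq_ext with (fun k => 0 / INR k ^ 2 - eps k (INR k)).
    + intros k. rewrite HQn. unfold Rdiv. ring.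
    + replace (Finite 0) with (Finite (0 - 0)) by (f_equal; ring).
      apply is_lim_seq_minus'; [apply inv_INR_sq_lim|apply eps_lim]. }
assert (E : / (8 * y ^ 2) = / 8 * / y ^ 2) by (field; lra).
assert (HI : 0 < / y ^ 2) by (apply Rinv_0_lt_compat, pow_lt; lra).
pose proof (HQ n y Hy). unfold Rdiv in *.
apply Rabs_le. rewrite E. split; nra.
Qed.

Lemma ceps_lim : is_lim_seq (fun n => ceps n (INR n)) 0.
Proof.
unfold ceps.
replace (Finite 0) with (Finite (0 - 2 * 0 - 2 * 0)) by (f_equal; ring).
apply is_lim_seq_minus'; [apply is_lim_seq_minus'|].
2: apply is_lim_seq_mult'; [apply is_lim_seq_const|apply leps_lim].
2: apply is_lim_seq_mult'; [apply is_lim_seq_const|apply eps_lim].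
(* The product [ln n * eps n] tends to 0 by [eps_bound], which needs [n >= 1]. *)
apply is_lim_seq_incr_1. apply is_lim_seq_abs_0.
apply is_lim_seq_le_le with (u := fun _ => 0) (w := fun n => ln (INR (S n)) / INR (S n)).
- intros n. split; [apply Rabs_pos|].
  pose proof (INR_ge1 (S n) ltac:(lia)) as H.
  pose proof (eps_bound (S n) (INR (S n)) ltac:(lia) ltac:(lra)) as Hb.
  set (m := INR (S n)) in *. pose proof (ln_nonneg m H).
  rewrite !Rabs_mult, (Rabs_right 2), (Rabs_right (ln m)) by lra.
  assert (/ (8 * m ^ 2) <= / (2 * m)) by (apply Rinv_le_contravar; nra).
  assert (E : / (2 * m) = / m / 2) by (field; lra).
  pose proof (Rabs_pos (eps (S n) m)). unfold Rdiv in *. nra.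
- apply is_lim_seq_const.
- apply (is_lim_seq_incr_1 (fun n => ln (INR n) / INR n)). apply ln_div_lim.
Qed.

(** By [eps_bound] the derivative [2 eps / y] of [ceps] is at most [1 / (4 y^3)] in absolute value,
    so both [1 / (8 y^2) + ceps] and [1 / (8 y^2) - ceps] decrease to 0. *)
Lemma ceps_bound (n : nat) (y : R) :
  (1 <= n)%nat -> INR n <= y <= INR n + 1 -> Rabs (ceps n y) <= / (8 * y ^ 2).
Proof.
intros Hn Hy. pose proof (INR_ge1 n Hn) as Hn1.
assert (Hb : forall s, s = 1 \/ s = -1 -> 0 <= / 8 / y ^ 2 + s * ceps n y).
{ intros s Hs.
  apply (piecewise_decreasing_nonneg (fun n y => / 8 / y ^ 2 + s * ceps n y)
     (fun n y => - (/ 4 / y ^ 3) + s * (2 * eps n y / y))); [| | |exact Hn|exact Hy].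
  - intros m t Hm Ht. pose proof (INR_ge1 m Hm). split.
    + apply (is_derive_plus (fun t => / 8 / t ^ 2)).
      * auto_derive; [nra|]. field. lra.
      * apply is_derive_scal. apply ceps_derive. lra.
    + pose proof (eps_bound m t Hm Ht) as Hb. apply Rabs_le_between in Hb.
      replace (- (/ 4 / t ^ 3) + s * (2 * eps m t / t)) with
        (2 / t * (s * eps m t - / (8 * t ^ 2))) by (field; lra).
      assert (0 < 2 / t) by (apply Rdiv_lt_0_compat; lra).
      destruct Hs as [-> | ->]; nra.
  - intros m Hm. rewrite ceps_succ. reflexivity.
  - replace (Finite 0) with (Finite (0 + s * 0)) by (f_equal; ring).
    apply is_lim_seq_plus'; [apply inv_INR_sq_lim|].
    apply is_lim_seq_mult'; [apply is_lim_seq_const|apply ceps_lim]. }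
pose proof (Hb 1 ltac:(lra)). pose proof (Hb (-1) ltac:(lra)).
replace (/ (8 * y ^ 2)) with (/ 8 / y ^ 2) by (field; lra).
apply Rabs_le. lra.
Qed.

(** At [n = y = 1] the remainder [eps] equals [1/2 - euler_gamma]. *)
Lemma euler_gamma_bounds : 3 / 8 <= euler_gamma <= 5 / 8.
Proof.
pose proof (eps_bound 1 1 ltac:(lia) ltac:(simpl; lra)) as H.
apply Rabs_le_between in H. unfold eps, harm in H. simpl in H. rewrite ln_1 in H.
lra.
Qed.

(** * Error terms *)

Lemma dsum_ext (f g : R -> R) (u : R) :
  (forall t, 0 < t -> f t = g t) -> dsum f u = dsum g u.
Proof.
intros H. apply sm_ext; intros a Ha. apply sm_ext; intros b Hb. apply H.
pose proof (INR_ge1 a ltac:(lia)). pose proof (INR_ge1 b ltac:(lia)). nra.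
Qed.

Lemma dsum_plus (f g : R -> R) (u : R) :
  dsum (fun t => f t + g t) u = dsum f u + dsum g u.
Proof. unfold dsum. rewrite <- sm_plus. apply sm_ext; intros. apply sm_plus. Qed.

Lemma dsum_scal (c : R) (f : R -> R) (u : R) : dsum (fun t => c * f t) u = c * dsum f u.
Proof. unfold dsum. rewrite <- sm_scal. apply sm_ext; intros. apply sm_scal. Qed.

Lemma dsum_abs_le (f g : R -> R) (u : R) :
  (forall t, 0 < t -> Rabs (f t) <= g t) -> Rabs (dsum f u) <= dsum g u.
Proof.
intros H. unfold dsum. eapply Rle_trans; [apply sm_abs|]. apply sm_le; intros a Ha.
eapply Rle_trans; [apply sm_abs|]. apply sm_le; intros b Hb. apply H.
pose proof (INR_ge1 a ltac:(lia)). pose proof (INR_ge1 b ltac:(lia)). nra.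
Qed.

(** The function psi of the outline. *)
Definition saw (v : R) : R := v - INR (fl v) - 1 / 2.

Lemma saw_bound (v : R) : 0 <= v -> Rabs (saw v) <= 1 / 2.
Proof. intros Hv. destruct (fl_spec v Hv). unfold saw. apply Rabs_le. lra. Qed.

Lemma harm_fl (v : R) :
  0 < v -> harm (fl v) = ln v + euler_gamma - saw v / v + eps (fl v) v.
Proof. intros Hv. unfold eps, saw. field. lra. Qed.

Lemma saw_sum_bound (u : R) (N : nat) :
  0 <= u -> Rabs (sm (fun a => saw (u / INR a)) N) <= INR N / 2.
Proof.
intros Hu. eapply Rle_trans; [apply sm_abs|].
eapply Rle_trans; [apply (sm_le _ (fun _ => 1 / 2))|rewrite sm_const; lra].
intros a Ha. apply saw_bound. apply div_nonneg; [exact Hu|lia].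
Qed.

(** An exact identity that keeps the sum of [saw], since in [dsum_inv_bound] this sum has to cancel
    rather than be estimated. *)
Lemma dsum_one_eq (u : R) (N : nat) :
  0 <= u -> INR N <= sqrt u < INR N + 1 ->
  dsum (fun _ => 1) u =
    2 * u * harm N - INR N - INR N ^ 2 - 2 * sm (fun a => saw (u / INR a)) N.
Proof.
intros Hu HN. rewrite (dsum_hyperbola _ u N Hu HN).
rewrite (sm_ext _ (fun a => u * / INR a - 1 / 2 - saw (u / INR a))).
2:{ intros a Ha. rewrite sm_const. unfold saw, Rdiv. ring. }
rewrite (sm_ext (fun a => sm _ N) (fun _ => INR N)).
2:{ intros a Ha. rewrite sm_const. ring. }
rewrite !sm_minus, sm_scal, !sm_const. fold (harm N). field.
Qed.

Lemma fl_sqrt (u : R) :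
  1 <= u -> (1 <= fl (sqrt u))%nat /\ INR (fl (sqrt u)) <= sqrt u < INR (fl (sqrt u)) + 1.
Proof.
intros Hu. pose proof (sqrt_le_1_alt 1 u Hu) as H. rewrite sqrt_1 in H. split.
- apply le_fl; simpl; lra.
- apply fl_spec. lra.
Qed.

Lemma ln_eq_sqrt (u : R) : 0 < u -> ln u = 2 * ln (sqrt u).
Proof.
intros Hu. pose proof (sqrt_lt_R0 u Hu).
rewrite <- (sqrt_sqrt u) at 1 by lra. rewrite ln_mult by assumption. ring.
Qed.

Definition Delta2 (u : R) : R :=
  dsum (fun _ => 1) u - (u * ln u + (2 * euler_gamma - 1) * u).

(** With [T] the fractional part of [sqrt u], the error is [2 u e + T (1 - T) - 2 P]. The parts are
    bounded by [1/4], [T] and [N], and [N + T = sqrt u]. *)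
Lemma Delta2_bound (u : R) : 1 <= u -> Rabs (Delta2 u) <= sqrt u + 1 / 4.
Proof.
intros Hu. destruct (fl_sqrt u Hu) as [HN1 HN]. set (N := fl (sqrt u)) in *.
unfold Delta2. rewrite (dsum_one_eq u N ltac:(lra) HN), (ln_eq_sqrt u) by lra.
pose proof (saw_sum_bound u N ltac:(lra)) as HP. apply Rabs_le_between in HP.
set (P := sm _ N) in *.
pose proof (eps_bound N (sqrt u) HN1 ltac:(lra)) as He. apply Rabs_le_between in He.
pose proof (INR_ge1 N HN1). pose proof (sqrt_sqrt u ltac:(lra)) as Es.
set (r := sqrt u) in *. set (e := eps N r) in *.
assert (Eh : harm N = ln r + euler_gamma - (r - INR N - 1 / 2) / r + e).
{ unfold e, eps. field. lra. }
rewrite Eh, <- Es.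
assert (Hre : - (1 / 8) <= r * r * e <= 1 / 8).
{ assert (E : / (8 * r ^ 2) * (r * r) = 1 / 8) by (field; lra).
  assert (0 < r * r) by nra. split; nra. }
set (T := r - INR N) in *.
match goal with |- Rabs ?X <= _ =>
  replace X with (2 * (r * r * e) + T * (1 - T) - 2 * P) by (unfold T; field; lra) end.
assert (0 <= T * (1 - T)) by (unfold T; nra).
assert (T * (1 - T) <= T) by (unfold T; nra).
apply Rabs_le. unfold T in *. lra.
Qed.

(** The sum of [d(n) / n] contributes [- 2 P / u] through the sawtooth part of [harm (fl (u / a))],
    and the sum of [d(n)] multiplied by [- 1 / u] contributes [2 P / u]. Only terms of size [1 / u]
    survive. *)
Lemma dsum_inv_bound (u : R) :
  1 <= u ->
  Rabs (dsum (fun t => / t - / u) u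
    - (ln u ^ 2 / 2 + (2 * euler_gamma - 1) * ln u + euler_gamma ^ 2
       - 2 * stieltjes 1 - 2 * euler_gamma + 1)) <= 77 / 100 / u.
Proof.
intros Hu. destruct (fl_sqrt u Hu) as [HN1 HN]. set (N := fl (sqrt u)) in *.
pose proof (INR_ge1 N HN1) as HNr. pose proof (sqrt_sqrt u ltac:(lra)) as Es.
rewrite (dsum_ext _ (fun t => / t + (- / u) * 1)) by (intros; ring).
rewrite dsum_plus, dsum_scal, (dsum_one_eq u N ltac:(lra) HN).
rewrite (dsum_hyperbola _ u N ltac:(lra) HN).
set (P := sm (fun a => saw (u / INR a)) N).
set (S := sm (fun a => / INR a * eps (fl (u / INR a)) (u / INR a)) N).
rewrite (sm_ext (fun a => sm _ N) (fun a => / INR a * harm N)).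
2:{ intros a Ha. unfold harm. rewrite <- sm_scal. apply sm_ext. intros b Hb. apply Rinv_mult. }
rewrite sm_scal_r. fold (harm N).
assert (Hle : forall a, (1 <= a <= N)%nat -> 1 <= u / INR a).
{ intros a Ha. pose proof (INR_ge1 a ltac:(lia)). apply div_le_iff; [lra|].
  pose proof (le_INR a N ltac:(lia)). nra. }
rewrite (sm_ext (fun a => sm _ _) (fun a => (ln u + euler_gamma) * / INR a - ln (INR a) / INR a
   - / u * saw (u / INR a) + / INR a * eps (fl (u / INR a)) (u / INR a))).
2:{ intros a Ha. pose proof (INR_ge1 a ltac:(lia)). pose proof (Hle a Ha).
    transitivity (/ INR a * harm (fl (u / INR a))).
    - unfold harm. rewrite <- sm_scal. apply sm_ext. intros b Hb. apply Rinv_mult.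
    - rewrite harm_fl by lra. rewrite ln_div by lra. field. lra. }
rewrite sm_plus, !sm_minus, !sm_scal. fold (harm N) (lharm N) P S.
assert (HS : Rabs S <= INR N * (INR N + 1) / (16 * u ^ 2)).
{ unfold S. eapply Rle_trans; [apply sm_abs|].
  eapply Rle_trans; [apply (sm_le _ (fun a => / (8 * u ^ 2) * INR a))|].
  - intros a Ha. pose proof (INR_ge1 a ltac:(lia)). pose proof (Hle a Ha).
    rewrite Rabs_mult, Rabs_right by (left; apply Rinv_0_lt_compat; lra).
    assert (H1 : (1 <= fl (u / INR a))%nat) by (apply le_fl; simpl; lra).
    destruct (fl_spec (u / INR a) ltac:(lra)).
    pose proof (eps_bound (fl (u / INR a)) (u / INR a) H1 ltac:(lra)) as Hb.
    apply Rle_trans with (/ INR a * / (8 * (u / INR a) ^ 2)).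
    + apply Rmult_le_compat_l; [left; apply Rinv_0_lt_compat; lra|exact Hb].
    + right. field. lra.
  - rewrite sm_scal. rewrite sm_INR. right. field. lra. }
rewrite (ln_eq_sqrt u) by lra.
pose proof (eps_bound N (sqrt u) HN1 ltac:(lra)) as He.
pose proof (ceps_bound N (sqrt u) HN1 ltac:(lra)) as HJ.
set (r := sqrt u) in *. set (e := eps N r) in *. set (J := ceps N r) in *.
set (q := r - INR N - 1 / 2).
assert (Eh : harm N = ln r + euler_gamma - q / r + e).
{ unfold e, eps, q. field. lra. }
(* Expressing the remainder through [J] lets the terms [ln r * e] cancel against those of [harm N],
   so no logarithm enters the error. *)
assert (El : lharm N = ln r ^ 2 / 2 + stieltjes 1 - q * ln r / r + (ln r * e - e - J / 2)).
{ unfold J, ceps. fold e. unfold leps, q. field. lra. }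
rewrite Eh, El. rewrite <- Es in *.
match goal with |- Rabs ?X <= _ =>
  replace X with (- (1 / (4 * (r * r))) + 2 * S + J + 2 * (q / r * e) - e * e)
  by (unfold q; field; lra) end.
assert (HSr : Rabs S <= 1 / (8 * (r * r))).
{ eapply Rle_trans; [exact HS|].
  replace (1 / (8 * (r * r))) with ((2 * (r * r)) / (16 * (r * r) ^ 2)) by (field; lra).
  apply Rmult_le_compat_r; [left; apply Rinv_0_lt_compat; nra|nra]. }
assert (Hq : -1 / 2 <= q <= 1 / 2) by (unfold q; lra).
set (w := / (8 * r ^ 2)) in *.
assert (Hw : 0 < w <= 1 / 8).
{ unfold w. split; [apply Rinv_0_lt_compat; nra|].
  replace (1 / 8) with (/ 8) by field. apply Rinv_le_contravar; nra. }
assert (Hqr : -1 / 2 <= q / r <= 1 / 2).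
{ split; [apply (Rle_div_r _ _ r)|apply (Rle_div_l _ _ r)]; lra. }
replace (1 / (8 * (r * r))) with w in HSr by (unfold w; field; lra).
replace (1 / (4 * (r * r))) with (2 * w) by (unfold w; field; lra).
(* The five terms are at most [2 w], [2 w], [w], [w] and [w / 8], in total [6.125 w]. *)
replace (77 / 100 / (r * r)) with (616 / 100 * w) by (unfold w; field; lra).
apply Rabs_le_between in HSr, He, HJ. set (p := q / r) in *.
assert (- w <= 2 * (p * e) <= w) by (split; nra).
assert (0 <= e * e <= w / 8) by (split; nra).
apply Rabs_le. lra.
Qed.

(** With [B = x / A], the weight [fl (x / t) - A] is [x (1/t - 1/B) - 1/2 - saw (x / t)]. The terms
    [1 / (2A)] and [ln A / (2A)] in the expansions of [harm A] and [lharm A] cancel the main part of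
    half the sum of [d(n)] over [n <= B]. *)
Lemma Delta3_eq (x : R) (A : nat) :
  (1 <= A)%nat -> INR A <= x ->
  Delta3 x =
    sm (fun c => Delta2 (x / INR c)) A - Delta2 (x / INR A) / 2
    - dsum (fun t => saw (x / t)) (x / INR A)
    + x * ((ln (x / INR A) + 2 * euler_gamma) * eps A (INR A) + ceps A (INR A) / 2)
    + x * (dsum (fun t => / t - / (x / INR A)) (x / INR A)
       - (ln (x / INR A) ^ 2 / 2 + (2 * euler_gamma - 1) * ln (x / INR A) + euler_gamma ^ 2
       - 2 * stieltjes 1 - 2 * euler_gamma + 1)).
Proof.
intros HA HAx. pose proof (INR_ge1 A HA) as HA1.
unfold Delta3, main_term3. rewrite (T3_split x A ltac:(lra) HA HAx).
rewrite (sm_ext (fun c => Delta2 (x / INR c)) (fun c => dsum (fun _ => 1) (x / INR c)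
  - (x * (ln x + 2 * euler_gamma - 1) * / INR c - x * (ln (INR c) / INR c)))).
2:{ intros c Hc. pose proof (INR_ge1 c ltac:(lia)). unfold Delta2.
    rewrite ln_div by lra. field. lra. }
rewrite !sm_minus, !sm_scal. fold (harm A) (lharm A).
rewrite (dsum_ext (fun t => INR (fl (x / t)) - INR A)
  (fun t => (x * (/ t - / (x / INR A)) + (- (1 / 2)) * 1) + (-1) * saw (x / t))).
2:{ intros t Ht. unfold saw. field. lra. }
rewrite !dsum_plus, !dsum_scal. unfold Delta2.
set (W := dsum (fun t => / t - / (x / INR A)) _).
set (V := dsum (fun t => saw (x / t)) _).
set (T := dsum (fun _ => 1) (x / INR A)).
unfold ceps, leps, eps. rewrite ln_div by lra. field. lra.
Qed.

(** The coefficient [102/100] is [1/4] from the bounds on [Delta2] plus [77/100] from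
    [dsum_inv_bound]. With [euler_gamma <= 5/8], [1/4] bounds [2 euler_gamma - 1], and [7/4] bounds
    [2 euler_gamma + 1/2]. *)
Lemma Delta3_bound (x : R) (A : nat) :
  (1 <= A)%nat -> INR A <= x ->
  Rabs (Delta3 x) <=
    sqrt x * (2 * sqrt (INR A) - 1) + 102 / 100 * INR A
    + x / (2 * INR A) * (ln (x / INR A) + 1 / 4)
    + x / (8 * INR A ^ 2) * (ln (x / INR A) + 7 / 4).
Proof.
intros HA HAx. pose proof (INR_ge1 A HA) as HA1.
rewrite (Delta3_eq x A HA HAx).
assert (HB : 1 <= x / INR A) by (apply div_le_iff; lra).
pose proof (dsum_inv_bound _ HB) as HW. pose proof (Delta2_bound _ HB) as HD.
pose proof euler_gamma_bounds as Hg.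
pose proof (eps_bound A (INR A) HA ltac:(lra)) as He.
pose proof (ceps_bound A (INR A) HA ltac:(lra)) as HJ.
assert (HV : Rabs (dsum (fun t => saw (x / t)) (x / INR A)) <=
  1 / 2 * dsum (fun _ => 1) (x / INR A)).
{ rewrite <- dsum_scal. apply dsum_abs_le. intros t Ht. rewrite Rmult_1_r.
  apply saw_bound. apply Rmult_le_pos; [lra|left; apply Rinv_0_lt_compat, Ht]. }
assert (ET : dsum (fun _ => 1) (x / INR A) = Delta2 (x / INR A) + (x / INR A * ln (x / INR A)
  + (2 * euler_gamma - 1) * (x / INR A))) by (unfold Delta2; ring).
rewrite ET in HV.
(* The term [c = A] is isolated to combine with [- Delta2 B / 2] and with the [Delta2 B / 2] inside
   the bound on the [saw] sum. In total [Delta2 B] then has coefficient 1 in the upper estimate and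
   0 in the lower one. *)
destruct A as [|A']; [lia|]. cbn [sm].
set (A := S A') in *.
assert (HS : Rabs (sm (fun c => Delta2 (x / INR c)) A') <=
  sqrt x * (2 * sqrt (INR A) - 1) - sqrt (x / INR A) + 1 / 4 * (INR A - 1)).
{ eapply Rle_trans; [apply sm_abs|].
  eapply Rle_trans; [apply (sm_le _ (fun c => sqrt x * / sqrt (INR c) + 1 / 4))|].
  - intros c Hc. pose proof (INR_ge1 c ltac:(lia)).
    pose proof (le_INR c A ltac:(unfold A; lia)).
    replace (sqrt x * / sqrt (INR c)) with (sqrt (x / INR c)) by (apply sqrt_div_alt; lra).
    apply Delta2_bound. apply div_le_iff; lra.
  - rewrite sm_plus, sm_scal, sm_const.
    pose proof (sm_inv_sqrt A HA) as Hs. unfold A in Hs at 1. cbn [sm] in Hs. fold A in Hs.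
    rewrite sqrt_div_alt by lra. unfold A at 3. rewrite S_INR.
    pose proof (sqrt_pos x). unfold Rdiv. nra. }
set (B := x / INR A) in *.
set (s := sqrt x * (2 * sqrt (INR A) - 1)) in *.
set (v := dsum (fun t => saw (x / t)) B) in *.
set (w := dsum (fun t => / t - / B) B - _) in *.
set (dd := Delta2 B) in *. set (SS := sm (fun c => Delta2 (x / INR c)) A') in *.
set (b := ln B) in *. assert (Hb : 0 <= b) by (apply ln_nonneg; lra).
assert (HxW : Rabs (x * w) <= 77 / 100 * INR A).
{ rewrite Rabs_mult, Rabs_right by lra.
  replace (77 / 100 * INR A) with (x * (77 / 100 / B)) by (unfold B; field; lra).
  apply Rmult_le_compat_l; lra. }
assert (HxE : Rabs (x * ((b + 2 * euler_gamma) * eps A (INR A) + ceps A (INR A) / 2)) <=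
  x / (8 * INR A ^ 2) * (b + 7 / 4)).
{ rewrite Rabs_mult, Rabs_right by lra.
  replace (x / (8 * INR A ^ 2) * (b + 7 / 4)) with (x * (/ (8 * INR A ^ 2) * (b + 7 / 4)))
    by (field; lra).
  apply Rmult_le_compat_l; [lra|].
  apply Rabs_le_between in He, HJ. set (h := / (8 * INR A ^ 2)) in *.
  apply Rabs_le. split; nra. }
replace (x / (2 * INR A) * (b + 1 / 4)) with (1 / 2 * (B * b + 1 / 4 * B))
  by (unfold B; field; lra).
assert ((2 * euler_gamma - 1) * B <= 1 / 4 * B) by nra.
apply Rabs_le_between in HxW, HxE, HD, HV, HS.
apply Rabs_le. lra.
Qed.

(** * Choice of the splitting point *)

(** The difference vanishes at 1 and its derivative is a square over a positive quantity. Together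
    with [ln_le_half_diff] this gives numerical bounds, sharp for [t] near 1. *)
Lemma ln_ge (t : R) : 1 <= t -> 2 * (t - 1) / (t + 1) <= ln t.
Proof.
intros Ht.
destruct (mvt (fun t => ln t - 2 * (t - 1) / (t + 1)) (fun t => (t - 1) ^ 2 / (t * (t + 1) ^ 2))
  1 t Ht) as [c [Hc E]].
- intros s Hs. auto_derive; [lra|]. field. lra.
- rewrite ln_1 in E.
  assert (0 <= (c - 1) ^ 2 / (c * (c + 1) ^ 2)).
  { apply Rmult_le_pos; [apply pow2_ge_0|].
    left. apply Rinv_0_lt_compat. pose proof (pow_lt (c + 1) 2 ltac:(lra)). nra. }
  replace (2 * (1 - 1) / (1 + 1)) with 0 in E by field. nra.
Qed.

Lemma ln_le_half_diff (t : R) : 1 <= t -> ln t <= (t - / t) / 2.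
Proof.
intros Ht.
destruct (mvt (fun t => (t - / t) / 2 - ln t) (fun t => (t - 1) ^ 2 / (2 * t ^ 2))
  1 t Ht) as [c [Hc E]].
- intros s Hs. auto_derive; [lra|]. field. lra.
- rewrite ln_1, Rinv_1 in E.
  assert (0 <= (c - 1) ^ 2 / (2 * c ^ 2)).
  { apply Rmult_le_pos; [apply pow2_ge_0|].
    left. apply Rinv_0_lt_compat. pose proof (pow_lt c 2 ltac:(lra)). nra. }
  nra.
Qed.

Lemma ln2_bounds : 685 / 1000 <= ln 2 <= 71 / 100.
Proof.
replace 2 with (4 / 3 * (3 / 2)) by field. rewrite ln_mult by lra.
pose proof (ln_ge (4 / 3) ltac:(lra)). pose proof (ln_ge (3 / 2) ltac:(lra)).
pose proof (ln_le_half_diff (4 / 3) ltac:(lra)). pose proof (ln_le_half_diff (3 / 2) ltac:(lra)).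
split; lra.
Qed.

Lemma ln3_le : ln 3 <= 113 / 100.
Proof.
replace 3 with (2 * (3 / 2)) by field. rewrite ln_mult by lra.
pose proof ln2_bounds. pose proof (ln_le_half_diff (3 / 2) ltac:(lra)). lra.
Qed.

Lemma ln_prime_powers : ln 4 = 2 * ln 2 /\ ln 8 = 3 * ln 2 /\ ln 27 = 3 * ln 3.
Proof.
replace 4 with (2 * 2) by ring. replace 8 with (2 * (2 * 2)) by ring.
replace 27 with (3 * (3 * 3)) by ring. rewrite !ln_mult by lra. lra.
Qed.

Lemma Rpower_third_cube (t : R) : 0 < t -> Rpower t (1 / 3) ^ 3 = t.
Proof.
intros Ht. rewrite <- Rpower_pow by apply exp_pos. rewrite Rpower_mult.
replace (1 / 3 * INR 3) with 1 by (simpl; field). apply Rpower_1, Ht.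
Qed.

Lemma Rpower_two_thirds (t : R) : Rpower t (2 / 3) = Rpower t (1 / 3) ^ 2.
Proof. simpl. rewrite Rmult_1_r, <- Rpower_plus. f_equal. field. Qed.

Lemma cube_le (a b : R) : 0 <= b -> a ^ 3 <= b ^ 3 -> a <= b.
Proof. intros Hb H. destruct (Rle_lt_dec a b) as [|Hlt]; [assumption|]. exfalso.
assert (0 < a - b) by lra. assert (0 < a * a) by nra.
assert (0 < (a - b) * (a * a + a * b + b * b)) by (apply Rmult_lt_0_compat; nra). nra. Qed.

Definition size3 (x : R) : R := Rpower x (2 / 3) * Rpower (ln x) (1 / 3).

(** Since [size3 x = x (ln x / x)^(1/3)], on a bounded range the target can be replaced by a linear
    function of [x]. *)
Lemma size3_ge (c x : R) :
  0 <= c -> 0 < x -> 0 < ln x -> c ^ 3 <= ln x / x -> c * x <= size3 x.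
Proof.
intros Hc Hx Hl H. unfold size3. rewrite Rpower_two_thirds.
pose proof (Rpower_third_cube x Hx) as Ep. pose proof (Rpower_third_cube (ln x) Hl) as Eq.
assert (Hp : 0 < Rpower x (1 / 3)) by apply exp_pos.
assert (Hq : 0 < Rpower (ln x) (1 / 3)) by apply exp_pos.
set (p := Rpower x (1 / 3)) in *. set (q := Rpower (ln x) (1 / 3)) in *.
assert (H1 : c * p <= q).
{ apply cube_le; [lra|]. apply (Rle_div_r _ _ x) in H; [|lra].
  rewrite Eq. rewrite Rpow_mult_distr, Ep. exact H. }
rewrite <- Ep. replace (c * p ^ 3) with (p ^ 2 * (c * p)) by ring.
apply Rmult_le_compat_l; [apply pow2_ge_0|exact H1].
Qed.

(** The case [A = 1]. On this range [ln x / x] is at least [ln 2 / 2 = ln 4 / 4], as it rises up to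
    [e] and then falls; the other terms are bounded by linear functions of [x]. *)
Lemma Delta3_bound_2_4 (x : R) :
  2 <= x <= 4 -> Rabs (Delta3 x) <= 3369 / 1000 * size3 x.
Proof.
intros Hx. destruct ln2_bounds as [L1 L2]. pose proof ln3_le as L3. pose proof ln3_ge1 as L3'.
destruct ln_prime_powers as [E4 _].
pose proof (ln_le 2 x ltac:(lra) ltac:(lra)) as Hl.
assert (HP : 698 / 1000 * x <= size3 x).
{ apply size3_ge; [lra|lra|lra|].
  apply Rle_trans with (ln 2 / 2); [lra|].
  destruct (Rle_dec (ln x) 1) as [H1|H1].
  - apply ln_div_incr; lra.
  - replace (ln 2 / 2) with (ln 4 / 4) by (rewrite E4; field). apply ln_div_decr; lra. }
pose proof (Delta3_bound x 1 ltac:(lia) ltac:(simpl; lra)) as H.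
simpl INR in H. rewrite sqrt_1, Rdiv_1_r in H.
pose proof (ln_ratio_le 3 x ltac:(lra) ltac:(lra)) as Hu.
pose proof (sqrt_sqrt x ltac:(lra)) as Es. set (s := sqrt x) in *.
(* Tangent to the square root at [1.7^2]. Likewise [Hu] is the tangent to [ln] at 3, and the product
   inequality below replaces [x^2] by its chord. *)
assert (s <= (x + 289 / 100) / (34 / 10))
  by (pose proof (Rle_0_sqr (s - 17 / 10)) as Hq; unfold Rsqr in Hq; lra).
set (L := ln x) in *.
assert (HL : L <= x / 3 + 13 / 100) by lra.
assert (x * L <= x * (x / 3 + 13 / 100)) by (apply Rmult_le_compat_l; lra).
assert (0 <= (x - 2) * (4 - x)) by nra.
lra.
Qed.

(** The case [A = 2], by the same linearization. Cutting at 8 keeps the lower bounds for [ln x / x],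
    taken at the right endpoints 8 and 27, sharp enough. *)
Lemma Delta3_bound_4_27 (x : R) :
  4 <= x <= 27 -> Rabs (Delta3 x) <= 3369 / 1000 * size3 x.
Proof.
intros Hx. destruct ln2_bounds as [L1 L2]. pose proof ln3_le as L3. pose proof ln3_ge1 as L3'.
destruct ln_prime_powers as [E4 [E8 E27]].
pose proof (ln_le 4 x ltac:(lra) ltac:(lra)) as Hl.
pose proof (Delta3_bound x 2 ltac:(lia) ltac:(simpl; lra)) as H.
replace (INR 2) with 2 in H by reflexivity. rewrite ln_div in H by lra.
assert (H2 : sqrt 2 <= 1415 / 1000).
{ pose proof (sqrt_sqrt 2 ltac:(lra)). pose proof (sqrt_pos 2). nra. }
pose proof (sqrt_sqrt x ltac:(lra)) as Es. pose proof (sqrt_pos x) as Hs.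
assert (H3 : sqrt x * (2 * sqrt 2 - 1) <= sqrt x * (183 / 100))
  by (apply Rmult_le_compat_l; lra).
set (s := sqrt x) in *. set (L := ln x) in *.
destruct (Rle_dec x 8) as [H8|H8].
- assert (HP : 63 / 100 * x <= size3 x).
  { apply size3_ge; [lra|lra|fold L; lra|].
    apply Rle_trans with (ln 8 / 8); [lra|]. apply ln_div_decr; [lra|fold L; lra]. }
  pose proof (ln_le x 8 ltac:(lra) ltac:(lra)) as Hu. fold L in Hu.
  assert (s <= x / 2) by nra.
  assert (x * (L - ln 2) <= x * (142 / 100)) by (apply Rmult_le_compat_l; lra).
  lra.
- assert (HP : 48 / 100 * x <= size3 x).
  { apply size3_ge; [lra|lra|fold L; lra|].
    apply Rle_trans with (ln 27 / 27); [lra|]. apply ln_div_decr; [lra|fold L; lra]. }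
  pose proof (ln_ratio_le 16 x ltac:(lra) ltac:(lra)) as Hu. fold L in Hu.
  assert (E16 : ln 16 = ln 8 + ln 2) by (rewrite <- ln_mult by lra; f_equal; ring).
  assert (s <= (x + 16) / 8)
    by (pose proof (Rle_0_sqr (s - 4)) as Hq; unfold Rsqr in Hq; lra).
  assert (x * (L - ln 2) <= x * (x / 16 + 113 / 100)) by (apply Rmult_le_compat_l; lra).
  assert (0 <= (x - 8) * (27 - x)) by nra.
  lra.
Qed.

(** With [P = size3 x], the identities [x L = P y] and [x y = P^2] turn every term of [Delta3_bound]
    into a multiple of [P], [P / y], [P / L] or [y], up to a constant. *)
Lemma Delta3_bound_large (x : R) :
  27 <= x -> Rabs (Delta3 x) <= 3369 / 1000 * size3 x.
Proof.
intros Hx. pose proof ln3_le as L3. pose proof ln3_ge1 as L3'.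
destruct ln_prime_powers as [_ [_ E27]].
pose proof (ln_le 27 x ltac:(lra) ltac:(lra)) as Hl.
pose proof (ln_div_decr 27 x ltac:(lra) ltac:(lra)) as Hd.
apply (Rle_div_l _ _ x) in Hd; [|lra].
unfold size3. rewrite Rpower_two_thirds.
pose proof (Rpower_third_cube x ltac:(lra)) as Ep.
pose proof (Rpower_third_cube (ln x) ltac:(lra)) as Eq.
assert (Hp : 0 < Rpower x (1 / 3)) by apply exp_pos.
assert (Hq : 0 < Rpower (ln x) (1 / 3)) by apply exp_pos.
set (p := Rpower x (1 / 3)) in *. set (q := Rpower (ln x) (1 / 3)) in *.
(* The constants are rounded values at [x = 27], where [p = 3]; [q / p] is the cube root of
   [ln x / x], which decreases from there. *)
assert (Hp3 : 3 <= p) by (apply cube_le; [lra|rewrite Ep; lra]).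
assert (Hq1 : 144 / 100 <= q) by (apply cube_le; [lra|rewrite Eq; lra]).
assert (Hqp : q <= 51 / 100 * p).
{ apply cube_le; [lra|]. rewrite Rpow_mult_distr, Ep, Eq. nra. }
set (L := ln x) in *.
set (P := p ^ 2 * q). set (y := p * q ^ 2).
assert (ExL : x * L = P * y) by (rewrite <- Ep, <- Eq; unfold P, y; ring).
assert (Exy : x * y = P * P) by (rewrite <- Ep; unfold P, y; ring).
assert (Hq2 : 2 <= q ^ 2) by nra. assert (Hp2 : 9 <= p ^ 2) by nra.
assert (Hy : 62 / 10 <= y).
{ unfold y. apply Rle_trans with (3 * q ^ 2); [nra|]. apply Rmult_le_compat_r; lra. }
assert (HP : 12 <= P).
{ unfold P. apply Rle_trans with (9 * q); [lra|]. apply Rmult_le_compat_r; lra. }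
assert (HyP : y <= 51 / 100 * P).
{ unfold y, P. replace (p * q ^ 2) with (p * q * q) by ring.
  replace (51 / 100 * (p ^ 2 * q)) with (p * q * (51 / 100 * p)) by ring.
  apply Rmult_le_compat_l; [nra|exact Hqp]. }
(* Guarantees [A <= x] for the [A] chosen below. *)
assert (HyL : y <= x / 2).
{ rewrite <- Ep. unfold y. replace (p ^ 3 / 2) with (p * (p * p / 2)) by field.
  apply Rmult_le_compat_l; [lra|]. nra. }
set (A := S (fl (y / 2))).
destruct (fl_spec (y / 2) ltac:(lra)) as [Hf1 Hf2].
assert (HA : y / 2 <= INR A <= y / 2 + 1) by (unfold A; rewrite S_INR; lra).
assert (HA1 : 1 <= INR A) by (apply INR_ge1; unfold A; lia).
pose proof (Delta3_bound x A ltac:(unfold A; lia) ltac:(lra)) as H.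
apply Rle_trans with (1 := H).
set (a := INR A) in *.
assert (Hb : 0 <= ln (x / a) <= L).
{ split; [apply ln_nonneg; apply div_le_iff; lra|]. rewrite ln_div by lra.
  pose proof (ln_nonneg a HA1). unfold L. lra. }
set (b := ln (x / a)) in *.
assert (HPy : P / y <= P / (62 / 10)).
{ apply Rmult_le_compat_l; [lra|]. apply Rinv_le_contravar; lra. }
assert (HPL : P / L <= P / 3).
{ apply Rmult_le_compat_l; [lra|]. apply Rinv_le_contravar; lra. }
assert (Ex1 : x / y = P / L)
  by (replace x with (x * L / L) at 1 by (field; lra); rewrite ExL; field; lra).
assert (Ex2 : x / P = P / y)
  by (replace x with (x * y / y) by (field; lra); rewrite Exy; field; lra).
(* As [x a <= P^2 / 2 + x], the leading part is about [sqrt 2 * P]. The weight [4/5] instead of the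
   optimal [1 / sqrt 2] costs about [0.011 P] but lowers the coefficient of [P / y]. *)
assert (B1 : sqrt x * (2 * sqrt a - 1) <= (8 / 10 + 625 / 1000) * P + 125 / 100 * (P / y)).
{ pose proof (sqrt_pos x) as Hs. pose proof (sqrt_sqrt x ltac:(lra)) as Es.
  pose proof (sqrt_sqrt a ltac:(lra)) as Ea.
  set (z := sqrt x * sqrt a).
  assert (Ez : z * z = x * a) by (unfold z; rewrite <- Ea, <- Es at 3; ring).
  apply Rle_trans with (2 * z); [unfold z; nra|].
  (* AM-GM: [2 z <= (4/5) P + z^2 / ((4/5) P)] *)
  apply Rle_trans with (8 / 10 * P + 125 / 100 * (x / P) * a).
  - apply (Rmult_le_reg_r P); [lra|].
    replace ((8 / 10 * P + 125 / 100 * (x / P) * a) * P)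
      with (8 / 10 * (P * P) + 125 / 100 * (x * a))
      by (field; lra). rewrite <- Ez.
    pose proof (Rle_0_sqr (P - 125 / 100 * z)) as Hsq. unfold Rsqr in Hsq. lra.
  - rewrite Ex2.
    replace ((8 / 10 + 625 / 1000) * P + 125 / 100 * (P / y)) with
      (8 / 10 * P + 125 / 100 * (P / y) * (y / 2 + 1)) by (field; lra).
    apply Rplus_le_compat_l, Rmult_le_compat_l; [|lra].
    apply Rmult_le_pos; [lra|]. apply Rlt_le, Rdiv_lt_0_compat; lra. }
(* From [2 a >= y] and [b <= L], with [x / y = P / L]. *)
assert (B2 : x / (2 * a) * (b + 1 / 4) <= P + 1 / 4 * (P / L)).
{ replace (P + 1 / 4 * (P / L)) with (P / L * (L + 1 / 4)) by (field; lra).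
  rewrite <- Ex1. apply Rmult_le_compat; [|lra| |lra].
  - apply Rlt_le, Rdiv_lt_0_compat; lra.
  - apply Rmult_le_compat_l; [lra|]. apply Rinv_le_contravar; lra. }
(* The factor is [1/2 + 7 / (8 L)], at most [19/24] because [L >= 3]. *)
assert (B3 : x / (8 * a ^ 2) * (b + 7 / 4) <= P / y * (8 / 10)).
{ pose proof (pow_lt y 2 ltac:(lra)). pose proof (pow_lt a 2 ltac:(lra)).
  pose proof (pow_incr y (2 * a) 2 ltac:(lra)) as Hya. rewrite Rpow_mult_distr in Hya.
  apply Rle_trans with (x / (2 * y ^ 2) * (L + 7 / 4)).
  - apply Rmult_le_compat; [|lra| |lra].
    + apply Rlt_le, Rdiv_lt_0_compat; lra.
    + apply Rmult_le_compat_l; [lra|]. apply Rinv_le_contravar; lra.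
  - replace (x / (2 * y ^ 2)) with (x / y / (2 * y)) by (field; lra). rewrite Ex1.
    replace (P / L / (2 * y) * (L + 7 / 4)) with (P / y * (1 / 2 + 7 / 8 * / L)) by (field; lra).
    apply Rmult_le_compat_l; [apply Rlt_le, Rdiv_lt_0_compat; lra|].
    assert (/ L <= / 3) by (apply Rinv_le_contravar; lra). lra. }
(* The remaining [102/100 * a] is at most [0.51 y + 1.02], absorbed by [y <= 0.51 P] and [P >= 12].
   The total is below [3.2 P]. *)
lra.
Qed.

Theorem theorem1p1 :
  forall x : R, 2 <= x ->
    T3 x = x * (ln x ^ 2 / 2 + (3 * euler_gamma - 1) * ln x
                + 3 * euler_gamma ^ 2 - 3 * euler_gamma
                - 3 * stieltjes 1 + 1) + Delta3 x
    /\ Rabs (Delta3 x) <= 3369 / 1000 * Rpower x (2 / 3) * Rpower (ln x) (1 / 3).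
Proof.
intros x Hx. split.
- unfold Delta3, main_term3. ring.
- rewrite Rmult_assoc. fold (size3 x).
  destruct (Rle_dec x 4); [apply Delta3_bound_2_4; lra|].
  destruct (Rle_dec x 27); [apply Delta3_bound_4_27; lra|].
  apply Delta3_bound_large. lra.
Qed.
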